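(* Let $a,b \in \mathbb{Z}$ be coprime and let $n$ be an odd prime. If $p \neq n$ is a prime which divides $\lambda_n(a,b)$, then $p > n$.
   Context: For $a,b \in \mathbb{Z}$ and an odd integer $n > 1$, define $\lambda_n(a,b) = \sum_{i=0}^{n-1} (-1)^i a^{n-1-i} b^i$. Equivalently, $\lambda_n(a,b) = \frac{a^n+b^n}{a+b}$ if $b \neq -a$, and $\lambda_n(a,b) = n a^{n-1}$ if $b = -a$. *)

(* Defs.v *)
From mathcomp Require Import all_boot all_order all_algebra.

Set Implicit Arguments.
Unset Strict Implicit.
Unset Printing Implicit Defensive.

Import GRing.Theory.

Local Open Scope ring_scope.

(* Meant for odd n > 1; the truncated subtraction [n - 1 - i] is exact since
   [i < n]. *)
Definition lambda (n : nat) (a b : int) : int :=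
  \sum_(i < n) (-1) ^+ i * a ^+ (n - 1 - i) * b ^+ i.

(* Main.v *)
Require Import Defs.
From mathcomp Require Import all_boot all_order all_algebra all_field.

Import GRing.Theory.
Local Open Scope ring_scope.

(** Write [u], [v] for the residues of [a] and [- b] in the field with [p]
    elements.  Modulo [p], [lambda n a b] is the cofactor of [u - v] in
    [u ^ n - v ^ n], so its vanishing forces [u ^ n = v ^ n]; by coprimality
    [v] is nonzero, and [t = u / v] is an [n]-th root of unity.
    As [n] is prime, the order of [t] is [1] or [n].  If [t = 1], the cofactor
    is [n * u ^ (n - 1)], which is nonzero because [p <> n].  So [t] has
    order [n], and as the multiplicative group has order [p - 1], [n] divides
    [p - 1]; in particular [n < p]. *)

(** The sum is the homogenized [n]-th cyclotomic polynomial: since [n] is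
    invertible in the field, its zeros [u / v] have order exactly [n], which
    must divide the order of the multiplicative group. *)
Lemma prime_dvd_card_of_cofactor_root (F : finFieldType) (n : nat) (u v : F) :
  prime n -> n%:R != 0 :> F -> (u != 0) || (v != 0) ->
  \sum_(i < n) u ^+ (n.-1 - i) * v ^+ i = 0 -> (n %| #|F|.-1)%N.
Proof.
move=> n_pr n_neq0 uv_neq0 sum0.
have n_gt0 := prime_gt0 n_pr.
have unvn : u ^+ n = v ^+ n by apply/eqP; rewrite -subr_eq0 subrXX sum0 mulr0.
have v_neq0 : v != 0.
  apply: contraTneq uv_neq0 => v0; rewrite v0 eqxx orbF negbK.
  by move/eqP: unvn; rewrite v0 expr0n gtn_eqF //= expf_eq0 n_gt0.
have tn1 : (u / v) ^+ n = 1 by rewrite expr_div_n unvn divff // expf_neq0.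
have [m prim_t] := prim_order_exists n_gt0 tn1.
case/primeP: (n_pr) => _ n_div /n_div/orP[/eqP m1 | /eqP mn].
  have uv : u = v.
    by move: (prim_expr_order prim_t); rewrite m1 expr1 => /divr1_eq.
  (* On the diagonal every summand equals [v ^+ n.-1]. *)
  have := sum0; rewrite uv (eq_bigr (fun=> v ^+ n.-1)); last first.
    by move=> i _; rewrite -exprD subnK // -ltnS prednK.
  rewrite sumr_const card_ord -mulr_natr => /eqP.
  by rewrite mulf_eq0 (negPf n_neq0) orbF expf_eq0 (negPf v_neq0) andbF.
rewrite -mn (prim_order_dvd prim_t).
have t_neq0 : u / v != 0.
  by apply: contra_eq_neq tn1 => ->; rewrite expr0n gtn_eqF //= eq_sym oner_neq0.
apply/eqP/(mulfI t_neq0).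
by rewrite mulr1 -exprS prednK ?expf_card // (ltnW (finNzRing_gt1 _)).
Qed.

Lemma intr_lambda (R : comNzRingType) (n : nat) (a b : int) :
  (lambda n a b)%:~R
    = \sum_(i < n) a%:~R ^+ (n.-1 - i) * (- b%:~R) ^+ i :> R.
Proof.
rewrite /lambda rmorph_sum; apply: eq_bigr => i _.
by rewrite !rmorphM !rmorphXn /= rmorphN1 subn1 [in RHS]exprNn mulrCA mulrA.
Qed.

Lemma intr_Fp_eq0 (p : nat) (z : int) :
  prime p -> (z%:~R == 0 :> 'F_p) = (p%:Z %| z)%Z.
Proof.
move=> p_pr.
have natE k : (k%:R == 0 :> 'F_p) = (p %| k)%N.
  by rewrite (dvdn_pcharf (pchar_Fp p_pr)).
by case: z => k; rewrite ?NegzE ?rmorphN ?oppr_eq0 dvdzE /= ?abszN natE.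
Qed.

Theorem corollary2p14 (a b : int) (n p : nat)
  (hab : coprimez a b)
  (hn : prime n) (hn_odd : odd n)
  (hp : prime p) (hpn : p <> n)
  (hdvd : (p%:Z %| lambda n a b)%Z) :
  (n < p)%N.
Proof.
have n_neq0 : n%:R != 0 :> 'F_p.
  rewrite -(dvdn_pcharf (pchar_Fp hp)) dvdn_prime2 //; exact/eqP.
have ab_neq0 : (a%:~R != 0 :> 'F_p) || (- b%:~R != 0 :> 'F_p).
  rewrite oppr_eq0 !intr_Fp_eq0 // -negb_and -dvdz_gcd (eqP hab).
  by rewrite dvdzE /= dvdn1 neq_ltn prime_gt1 ?orbT.
have := prime_dvd_card_of_cofactor_root _ _ _ _ hn n_neq0 ab_neq0.
rewrite -intr_lambda card_Fp // => ndvd.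
have lambda0 : (lambda n a b)%:~R = 0 :> 'F_p.
  by apply/eqP; rewrite intr_Fp_eq0.
have p_gt1 := prime_gt1 hp.
have p1_gt0 : (0 < p.-1)%N by rewrite -subn1 subn_gt0.
by rewrite -(prednK (ltnW p_gt1)) ltnS (dvdn_leq p1_gt0) ?ndvd.
Qed.
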